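(* Let $n\ge5$ and $\alpha\in\mathcal{E}_n=\mathrm{End}(\mathcal{T}_n)$. The principal right ideal of $\mathcal{E}_n$ generated by $\alpha$ is equal to: $$\alpha\mathcal{E}_n=\begin{cases}\mathcal{E}_n&\text{if }\alpha\in\mathcal{G}_n,\\ \mathcal{E}_n\setminus\mathcal{G}_n&\text{if }\alpha\in E_3,\\ A_{t,e}\cup E_2\cup C\cup E_1&\text{if }\alpha=\phi_{t,e}\in A,\\ E_2\cup C\cup E_1&\text{if }\alpha\in E_2,\\ B_{t,e}\cup E_1&\text{if }\alpha=\phi_{t,e}\in B,\\ C_{t,e}\cup E_1&\text{if }\alpha=\phi_{t,e}\in C,\\ E_1&\text{if }\alpha\in E_1.\end{cases}$$ Consequently, $\mathcal{G}_n$, $E_3$, $E_2$ and $E_1$ each consist of a single $\mathscr{R}$-class, whilst each remaining $\mathscr{R}$-class is the orbit of an element in $A$, $B$ or $C$.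
   Context: Maps are written on the right and composed left to right. $\mathcal{T}_n$ is the full transformation semigroup of all maps $\{1,\dots,n\}\to\{1,\dots,n\}$; $\mathcal{S}_n$, $\mathcal{A}_n$ are the symmetric and alternating groups, $\mathrm{id}$ the identity map, and $s^g=g^{-1}sg$ for $g\in\mathcal{S}_n$, $s\in\mathcal{T}_n$. $\mathcal{E}_n=\mathrm{End}(\mathcal{T}_n)$ is the monoid of all semigroup endomorphisms of $\mathcal{T}_n$ (not required to fix $\mathrm{id}$), and $\mathcal{G}_n=\mathrm{Aut}(\mathcal{T}_n)$. For $g\in\mathcal{S}_n$, $\psi_g:s\mapsto s^g$. For $t,e\in\mathcal{T}_n$, $\phi_{t,e}$ sends $s\mapsto t$ if $s\in\mathcal{S}_n\setminus\mathcal{A}_n$, $s\mapsto t^2$ if $s\in\mathcal{A}_n$, $s\mapsto e$ if $s\in\mathcal{T}_n\setminus\mathcal{S}_n$. By a known theorem of Schein and Teclezghi, $\mathcal{G}_n=\{\psi_g:g\in\mathcal{S}_n\}$ and, for $n\neq4$, $\mathcal{E}_n=\mathcal{G}_n\cup\{\phi_{t,e}: t^3=t,\ te=et=e^2=e\}$. Define the following subsets of $\mathcal{E}_n\setminus\mathcal{G}_n$ (in each case $\phi_{t,e}$ is assumed to lie in $\mathcal{E}_n$): $E_3=\{\phi_{t,e}: t\in\mathcal{S}_n\setminus\mathcal{A}_n,\ e\ne\mathrm{id}\}$; $A=\{\phi_{t,e}: t\in\mathcal{A}_n,\ t\neq\mathrm{id},\ e\neq\mathrm{id}\}$; $B=\{\phi_{t,e}: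 t\in\mathcal{T}_n\setminus\mathcal{S}_n,\ t\ne t^2,\ t^2\neq e,\ e\ne\mathrm{id}\}$; $E_2=\{\phi_{\mathrm{id},e}: e\ne\mathrm{id}\}$; $C=\{\phi_{t,e}: t\in\mathcal{T}_n\setminus\mathcal{S}_n,\ t=t^2,\ t\neq e,\ e\neq\mathrm{id}\}$; $E_1=\{\phi_{e,e}\}$. The orbit of $\alpha\in\mathcal{E}_n$ is $\alpha\mathcal{G}_n=\{\alpha\psi_g:g\in\mathcal{S}_n\}$. For $X\in\{A,B,C\}$ and $\phi_{t,e}\in X$, $X_{t,e}$ denotes the orbit $\phi_{t,e}\mathcal{G}_n$. $\mathscr{R}$ is Green's relation: $\alpha\mathrel{\mathscr{R}}\beta$ iff $\alpha\mathcal{E}_n=\beta\mathcal{E}_n$. *)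

(* Defs.v *)
From HB Require Import structures.
From mathcomp Require Import all_boot all_fingroup all_solvable.

Set Implicit Arguments.
Unset Strict Implicit.
Unset Printing Implicit Defensive.

Import GroupScope.

(* Maps act on the right: s * t is "first s, then t". The same monoid structure
   is used for maps of {1,...,n} and for endomorphisms, which are maps of the
   finite type [trans n]. An alias of {ffun T -> T} is needed to carry it. *)
Definition tmap (T : finType) : Type := {ffun T -> T}.

HB.instance Definition _ (T : finType) := Finite.on (tmap T).

Definition tmap_one (T : finType) : tmap T := [ffun x : T => x].
Definition tmap_mul (T : finType) (s t : tmap T) : tmap T :=
  [ffun x : T => t (s x)].

Lemma tmap_mulA (T : finType) : associative (@tmap_mul T).
Proof. by move=> s t u; apply/ffunP=> x; rewrite !ffunE. Qed.

Lemma tmap_mul1 (T : finType) : left_id (tmap_one T) (@tmap_mul T).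
Proof. by move=> s; apply/ffunP=> x; rewrite !ffunE. Qed.

Lemma tmap_mulr1 (T : finType) : right_id (tmap_one T) (@tmap_mul T).
Proof. by move=> s; apply/ffunP=> x; rewrite !ffunE. Qed.

HB.instance Definition _ (T : finType) :=
  isMonoid.Build (tmap T) (@tmap_mulA T) (@tmap_mul1 T) (@tmap_mulr1 T).

Notation trans n := (tmap 'I_n).

Definition perm_trans (n : nat) (g : 'S_n) : trans n := [ffun i => g i].

Definition symT (n : nat) : {set trans n} :=
  [set perm_trans g | g in [set: 'S_n]].

Definition altT (n : nat) : {set trans n} :=
  [set perm_trans g | g in 'Alt_('I_n)].

(* Semigroup endomorphisms: they need not fix 1. *)
Definition EndT (n : nat) : {set tmap (trans n)} :=
  [set f : tmap (trans n) |
    [forall s : trans n, forall t : trans n, f (s * t) == f s * f t]].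

Definition AutT (n : nat) : {set tmap (trans n)} :=
  [set f in EndT n | injectiveb f & [forall s : trans n, s \in codom f]].

Definition phi (n : nat) (t e : trans n) : tmap (trans n) :=
  [ffun s : trans n =>
    if s \in symT n :\: altT n then t
    else if s \in altT n then t ^+ 2
    else e].

Definition phi_set (n : nat) (P : trans n -> trans n -> bool) :
    {set tmap (trans n)} :=
  [set f in EndT n :\: AutT n |
    [exists t : trans n, exists e : trans n, (f == phi t e) && P t e]].

Definition E3 (n : nat) : {set tmap (trans n)} :=
  phi_set (fun t e => (t \in symT n :\: altT n) && (e != 1)).

Definition clsA (n : nat) : {set tmap (trans n)} :=
  phi_set (fun t e => [&& t \in altT n, t != 1 & e != 1]).

Definition clsB (n : nat) : {set tmap (trans n)} :=
  phi_set (fun t e => [&& t \notin symT n, t != t ^+ 2, t ^+ 2 != e & e != 1]).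

Definition E2 (n : nat) : {set tmap (trans n)} :=
  phi_set (fun t e => (t == 1) && (e != 1)).

Definition clsC (n : nat) : {set tmap (trans n)} :=
  phi_set (fun t e => [&& t \notin symT n, t == t ^+ 2, t != e & e != 1]).

Definition E1 (n : nat) : {set tmap (trans n)} :=
  phi_set (fun t e => t == e).

Definition right_ideal (n : nat) (a : tmap (trans n)) : {set tmap (trans n)} :=
  [set a * b | b in EndT n].

Definition Aut_orbit (n : nat) (a : tmap (trans n)) : {set tmap (trans n)} :=
  [set a * b | b in AutT n].

Definition greenR (n : nat) : rel (tmap (trans n)) :=
  fun a b => right_ideal a == right_ideal b.

Definition R_classes (n : nat) : {set {set tmap (trans n)}} :=
  [set [set b in EndT n | greenR a b] | a in EndT n].

(* Main.v *)
Require Import Defs.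
From mathcomp Require Import all_boot all_fingroup all_solvable.

(** Everything rests on the theorem of Schein and Teclezghi that, for [5 <= n],
    an endomorphism [f] of the full transformation semigroup T_n is either an
    automorphism or of the form [phi t e] ([endo_cases]). The proof splits on the
    restriction of [f] to the symmetric group S_n.

    If [f] is injective on S_n, then S_n acts faithfully on the image of the
    idempotent [f 1]; counting forces that image to be everything, so [f 1 = 1]
    and [f] permutes S_n. The constants are the maps [c] with [s * c = c] for
    all [s], so [f] sends the constant at [i] to the constant at some [h i], and
    [h (s i) = f s (h i)]. By 2-transitivity [h] is either injective or
    constant; a constant value would be fixed by all of S_n, hence [h] is a
    bijection and [f] is conjugation by [h] ([endo_inj_Aut]).

    If [f] is not injective on S_n, simplicity of the alternating group makes
    [f] constant on even permutations, hence on odd ones too. The idempotents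
    [collapse x y] of rank n - 1 absorb the transposition of [x] and [y] on the
    left and commute with every transposition disjoint from [x] and [y], so
    their images absorb the image of any permutation. They are all conjugate,
    hence all have the same image [e]. Every singular map is a permutation times
    a product of such idempotents, so it is sent to [e] as well ([endo_sing]).

    With this classification, [phi t e * b = phi (b t) (b e)] reduces the
    ideals to a calculation. Let [b = phi u f] and [e <> 1], so that the
    idempotent [e] is singular. Then [phi t e * b] is [b] when [t] is an odd
    permutation, [phi (u * u) f] when [t] is an even one, and the constant [phi
    f f] when [t] is singular. The union of E2, C and E1 consists exactly of
    the [phi w f] with [w] idempotent ([mem_idemPhi]). So a non-automorphism
    [a] in A or E2 multiplies the non-automorphisms into that union and fixes
    it pointwise, and similarly with E1 when [a] is in B or C. Hence the right
    ideal of [a] is its orbit together with that set ([right_ideal_orbit]).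

    For the R-classes, elements of E3 and of E2 are themselves idempotent: if
    [a = b * d] is one of them, then [a = b * (d * a)] with [d * a] not an
    automorphism, which confines [a] to E1 or to the union above unless [b] has
    the right type. In A, B and C, a multiplier that is not an automorphism
    moves [a] into a right ideal that does not contain [a]. *)

Set Implicit Arguments.
Unset Strict Implicit.
Unset Printing Implicit Defensive.

Import GroupScope.

Local Notation perm_map := Defs.perm_trans.

(** * Transformations: constants, permutations, parity *)

Lemma tmapM (T : finType) (s t : tmap T) (x : T) : (s * t) x = t (s x).
Proof. by rewrite ffunE. Qed.

Lemma tmap1 (T : finType) (x : T) : (1 : tmap T) x = x.
Proof. by rewrite ffunE. Qed.

Definition cst (n : nat) (i : 'I_n) : trans n := [ffun => i].

Definition collapse (n : nat) (x y : 'I_n) : trans n :=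
  [ffun i => if i == x then y else i].

Lemma mul_cst n (s : trans n) i : s * cst i = cst i.
Proof. by apply/ffunP=> x; rewrite tmapM !ffunE. Qed.

Lemma cst_mul n (s : trans n) i : cst i * s = cst (s i).
Proof. by apply/ffunP=> x; rewrite tmapM !ffunE. Qed.

Lemma perm_mapM n (g h : 'S_n) :
  perm_map (g * h) = perm_map g * perm_map h.
Proof. by apply/ffunP=> x; rewrite tmapM !ffunE permM. Qed.

Lemma perm_map1 n : perm_map (1 : 'S_n) = 1.
Proof. by apply/ffunP=> x; rewrite tmap1 ffunE perm1. Qed.

Lemma perm_map_inj n : injective (@perm_map n).
Proof. by move=> g h /ffunP E; apply/permP=> x; have := E x; rewrite !ffunE. Qed.

Lemma perm_mapV n (g : 'S_n) : perm_map g * perm_map g^-1 = 1.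
Proof. by rewrite -perm_mapM mulgV perm_map1. Qed.

Lemma symTP n (s : trans n) : reflect (exists g, s = perm_map g) (s \in symT n).
Proof.
apply: (iffP imsetP) => [[g _ ->]|[g ->]]; first by exists g.
by exists g; rewrite ?inE.
Qed.

Lemma mem_symT n (g : 'S_n) : perm_map g \in symT n.
Proof. by apply/symTP; exists g. Qed.

Lemma mem_altT n (g : 'S_n) : (perm_map g \in altT n) = ~~ odd_perm g.
Proof. by rewrite (mem_imset _ _ (@perm_map_inj n)) Alt_even. Qed.

Lemma altT_sub n (s : trans n) : s \in altT n -> s \in symT n.
Proof. by case/imsetP=> g _ ->; exact: mem_symT. Qed.

Lemma symT_inj n (s : trans n) : (s \in symT n) = injectiveb s.
Proof.
apply/symTP/injectiveP => [[g ->] x y|s_inj].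
  by rewrite !ffunE; exact: perm_inj.
by exists (perm s_inj); apply/ffunP=> x; rewrite ffunE permE.
Qed.

Lemma symT_mulr n (s t : trans n) : s * t \in symT n -> s \in symT n.
Proof.
rewrite !symT_inj => /injectiveP st_inj; apply/injectiveP=> x y E.
by apply: st_inj; rewrite !tmapM E.
Qed.

Lemma symT_mull n (s t : trans n) : s * t \in symT n -> t \in symT n.
Proof.
move=> st; have := st; have /symTP[g ->] := symT_mulr st => gt.
have /symTP[h gtE] := gt; apply/symTP; exists (g^-1 * h).
rewrite perm_mapM -gtE mulgA -perm_mapM mulVg perm_map1.
by rewrite mul1g.
Qed.

Lemma EndTP n (f : tmap (trans n)) :
  reflect {morph f : s t / s * t} (f \in EndT n).
Proof.
rewrite inE; apply: (iffP forallP) => [H s t|H s].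
  by apply/eqP; move/forallP: (H s); apply.
by apply/forallP=> t; rewrite H.
Qed.

(** * Endomorphisms that are injective on the symmetric group *)

Lemma perm_2trans n (i j k l : 'I_n) : i != j -> k != l ->
  exists g : 'S_n, g i = k /\ g j = l.
Proof.
move=> ij kl; exists (tperm i k * tperm (tperm i k j) l).
split; rewrite permM; last by rewrite tpermL.
have jk : tperm i k j != k.
  by apply: contraNneq ij => E;
     rewrite -(inj_eq (@perm_inj _ (tperm i k))) E tpermL.
by rewrite tpermL (tpermD jk) // eq_sym.
Qed.

Lemma perm_1trans n (i j : 'I_n) : exists g : 'S_n, g i = j.
Proof. by exists (tperm i j); rewrite tpermL. Qed.

Section EndoInj.
Variables (n : nat) (f : tmap (trans n)).
Hypothesis (n1 : 1 < n) (fE : f \in EndT n).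
Hypothesis f_inj : injective (fun g : 'S_n => f (perm_map g)).

Let fM : {morph f : s t / s * t}. Proof. exact/EndTP. Qed.

(** [f 1] is an idempotent with image [X], and [f] of a permutation maps [X]
    bijectively onto itself. An injection of S_n into the permutations of [X]
    needs [X] to have at least n points. *)
Lemma endo_inj_unit : f 1 = 1.
Proof.
pose X := f 1 @: [set: 'I_n].
have fXK x : x \in X -> f 1 x = x.
  by case/imsetP=> y _ ->; rewrite -tmapM -fM mulg1.
have fX g x : f (perm_map g) x \in X.
  by rewrite -[perm_map g]mulg1 fM tmapM imset_f.
have fgK g x : x \in X -> f (perm_map g^-1) (f (perm_map g) x) = x.
  by move=> Xx; rewrite -tmapM -fM perm_mapV fXK.
(* [f g] restricted to [X], extended by the identity outside [X] *)
have ex g : exists p : 'S_n,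
    p \in perm_on X /\ forall x, x \in X -> p x = f (perm_map g) x.
  have p_inj : injective (fun x => if x \in X then f (perm_map g) x else x).
    move=> x y /=; case: ifP => Xx; case: ifP => Xy // E.
    - by rewrite -(fgK g x Xx) E fgK.
    - by rewrite -E fX in Xy.
    - by rewrite E fX in Xx.
  exists (perm p_inj); split=> [|x Xx]; last by rewrite permE Xx.
  by apply/subsetP=> x; rewrite inE permE; case: ifP => //; rewrite eqxx.
have [u uP] := fin_all_exists ex.
have u_inj : injective u.
  move=> g h E; apply: f_inj; rewrite /=.
  rewrite -[perm_map g]mul1g -[perm_map h]mul1g !fM; apply/ffunP=> x.
  have Xx : f 1 x \in X by rewrite imset_f.
  by rewrite !tmapM -(uP g).2 // -(uP h).2 // E.
have leX : (n`! <= #|X|`!)%N.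
  rewrite -card_Sn -(card_perm X) -cardsT -(card_imset _ u_inj).
  apply: subset_leq_card.
  by apply/subsetP=> _ /imsetP[g _ ->]; exact: (uP g).1.
have XT : X = setT.
  apply/eqP; rewrite eqEcard subsetT cardsT card_ord leqNgt; apply/negP=> ltX.
  move: leX; rewrite leqNgt => /negP; apply; apply: ltn_fact ltX.
  by apply/card_gt0P; exists (f 1 (Ordinal (ltnW n1))); rewrite imset_f.
by apply/ffunP=> x; rewrite tmap1 fXK // XT inE.
Qed.

(** Since [f 1 = 1], permutations have invertible images; an injective self-map
    of the finite set S_n is onto. *)
Lemma endo_inj_perm_surj g : exists h : 'S_n, f (perm_map h) = perm_map g.
Proof.
have ex h : exists p : 'S_n, f (perm_map h) = perm_map p.
  by apply/symTP; apply: (@symT_mulr _ _ (f (perm_map h^-1)));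
     rewrite -fM perm_mapV endo_inj_unit -perm_map1 mem_symT.
have [u uP] := fin_all_exists ex.
have u_inj : injective u.
  by move=> h k E; apply: f_inj; rewrite /= !uP E.
by exists (invF u_inj g); rewrite uP f_invF.
Qed.

(** [f] acts on the constants as a self-map [h] of the points, and
    [h (s i) = f s (h i)], so [f] is injective as soon as [h] is. *)
Lemma endo_inj_Aut : f \in AutT n.
Proof.
have tr k l : exists h : 'S_n, f (perm_map h) k = l.
  have [g <-] := perm_1trans k l.
  by have [h E] := endo_inj_perm_surj g; exists h; rewrite E ffunE.
pose h i := f (cst i) i.
(* [s * cst i = cst i] for every [s], so [f (cst i)] is invariant under the
   transitive group [f S_n] acting on its arguments *)
have fcst i : f (cst i) = cst (h i).
  apply/ffunP=> k; rewrite [RHS]ffunE; have [g <-] := tr i k.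
  by rewrite -tmapM -fM mul_cst.
have hM (s : trans n) i : h (s i) = f s (h i).
  have := fM (cst i) s; rewrite cst_mul !fcst cst_mul => /ffunP/(_ i).
  by rewrite !ffunE.
have h_inj : injective h.
  move=> i j E; apply/eqP; apply/negPn/negP=> ij.
  (* a collapsed pair can be carried to any other pair *)
  have h_cst k l : h k = h l.
    have [->//|kl] := eqVneq k l.
    have [g [<- <-]] := perm_2trans ij kl.
    by have := hM (perm_map g) i; have := hM (perm_map g) j;
       rewrite !ffunE E => -> ->.
  case/negP: ij; apply/eqP.
  have fix_h g : f (perm_map g) (h i) = h i by rewrite -hM (h_cst _ i).
  by have [g gi] := tr (h i) i; have [g' gj] := tr (h i) j;
     rewrite -gi fix_h -gj fix_h.
have [h' h'K hK] := injF_bij h_inj.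
have finj : injective f.
  by move=> s t E; apply/ffunP=> i; apply: h_inj; rewrite !hM E.
rewrite inE fE /=; apply/andP; split; first exact/injectiveP.
by apply/forallP=> s; have [f' _ fK] := injF_bij finj; rewrite -(fK s) codom_f.
Qed.

End EndoInj.

(** * Idempotents of rank n - 1 and the generation of singular maps *)

Variant trans_spec n : trans n -> Prop :=
  | TransOdd g of odd_perm g : trans_spec (perm_map g)
  | TransEven g of ~~ odd_perm g : trans_spec (perm_map g)
  | TransSing s of s \notin symT n : trans_spec s.

Lemma transP n (s : trans n) : trans_spec s.
Proof.
have [/symTP[g ->]|] := boolP (s \in symT n); last exact: TransSing.
by have [] := boolP (odd_perm g); [exact: TransOdd|exact: TransEven].
Qed.

Lemma phi_odd n (t e : trans n) (g : 'S_n) :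
  odd_perm g -> phi t e (perm_map g) = t.
Proof. by move=> go; rewrite ffunE inE mem_altT mem_symT go. Qed.

Lemma phi_even n (t e : trans n) (g : 'S_n) :
  ~~ odd_perm g -> phi t e (perm_map g) = t * t.
Proof. by move=> ge; rewrite ffunE inE mem_altT ge /= expg2. Qed.

Lemma phi_sing n (t e s : trans n) : s \notin symT n -> phi t e s = e.
Proof.
move=> sS; rewrite ffunE inE (negPf sS) andbF.
by case: ifP => // /altT_sub; rewrite (negPf sS).
Qed.

Lemma collapse_idem n (x y : 'I_n) : collapse x y * collapse x y = collapse x y.
Proof.
apply/ffunP=> i; rewrite tmapM !ffunE; case: (i =P x) => [_|/eqP/negPf->//].
by case: ifP.
Qed.

Lemma tperm_collapse n (x y : 'I_n) :
  perm_map (tperm x y) * collapse x y = collapse x y.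
Proof.
apply/ffunP=> i; rewrite tmapM !ffunE.
by case: tpermP => [->|->|/eqP/negPf-> /eqP/negPf _]; rewrite ?eqxx //; case: ifP.
Qed.

Lemma collapse_comm n (x y : 'I_n) (g : 'S_n) :
  g x = x -> g y = y ->
  collapse x y * perm_map g = perm_map g * collapse x y.
Proof.
move=> gx gy; apply/ffunP=> i; rewrite !tmapM !ffunE.
by rewrite -{2}gx (inj_eq perm_inj); case: ifP => // /eqP->.
Qed.

Lemma collapse_conj n (x y : 'I_n) (g : 'S_n) :
  collapse (g x) (g y) = perm_map g^-1 * collapse x y * perm_map g.
Proof.
apply/ffunP=> i; rewrite !tmapM !ffunE.
rewrite -{1}[i](permKV g) (inj_eq perm_inj).
by case: ifP => //; rewrite permKV.
Qed.

(** If [s x = s y] and [z] is outside the image of [s], redirect [x] to [z]: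
    this raises the rank by one, and [collapse z (s x)] undoes it. *)
Lemma sing_factor n (s : trans n) : s \notin symT n ->
  exists s' : trans n, exists z v : 'I_n,
    [/\ z != v, s = s' * collapse z v & #|codom s| < #|codom s'|].
Proof.
rewrite symT_inj => sI.
have [x [y xy sxy]] := injectivePn s sI.
have [z zN] : exists z, z \notin codom s.
  apply/existsP; apply: contraNT sI => /existsPn H.
  have /image_injP s_inj : #|codom s| == #|'I_n|.
    by apply/eqP/eq_card => z; rewrite !inE; apply/negPn/H.
  by apply/injectiveP=> i j; apply: s_inj.
pose s' : trans n := [ffun i => if i == x then z else s i].
have zs i : s i != z by apply: contraNneq zN => <-; exact: codom_f.
(* [x] is redirected, while [y] keeps [s x] in the image *)
exists s', z, (s x); split.
- by rewrite eq_sym.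
- apply/ffunP=> i; rewrite tmapM !ffunE.
  by case: (i =P x) => [->|_]; rewrite ?eqxx // (negPf (zs i)).
apply: proper_card; apply/properP; split.
  apply/subsetP=> _ /codomP[i ->].
  suff [j ->] : exists j, s i = s' j by exact: codom_f.
  have [->|ix] := eqVneq i x; last by exists i; rewrite ffunE (negPf ix).
  by exists y; rewrite ffunE eq_sym (negPf xy).
exists z => //; have -> : z = s' x by rewrite ffunE eqxx.
exact: codom_f.
Qed.

Lemma two_others n (x y : 'I_n) : 4 <= n ->
  exists z w : 'I_n, [/\ z != w, tperm z w x = x & tperm z w y = y].
Proof.
move=> n4; have : 1 < #|~: [set x; y]|.
  rewrite cardsCs setCK card_ord cards2.
  by apply: leq_trans (leq_sub2l n _) => [|]; first exact: (leq_sub2r 2 n4);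
     case: (x != y).
case/card_gt1P=> z [w]; rewrite !inE !negb_or => -[/andP[zx zy] /andP[wx wy] zw].
by exists z, w; split; rewrite ?tpermD.
Qed.

(** * Endomorphisms that are not injective on the symmetric group *)

Section EndoNonInj.
Variables (n : nat) (f : tmap (trans n)).
Hypothesis (n5 : 4 < n) (fE : f \in EndT n).

Let fM : {morph f : s t / s * t}. Proof. exact/EndTP. Qed.

Let mul_unit s : f s * f 1 = f s. Proof. by rewrite -fM mulg1. Qed.
Let unit_mul s : f 1 * f s = f s. Proof. by rewrite -fM mul1g. Qed.

Definition endo_ker : {set 'S_n} := [set g | f (perm_map g) == f 1].

Lemma endo_ker_group : group_set endo_ker.
Proof.
apply/group_setP; split=> [|g h]; first by rewrite inE perm_map1.
by rewrite !inE perm_mapM fM => /eqP-> /eqP->; rewrite -fM mulg1.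
Qed.
Canonical endo_ker_Group := Group endo_ker_group.

Lemma endo_kerJ g h : g \in endo_ker -> g ^ h \in endo_ker.
Proof.
rewrite !inE !perm_mapM !fM => /eqP->.
by rewrite unit_mul -fM -{2}[h]invgK perm_mapV.
Qed.

Hypothesis f_ninj : ~ injective (fun g : 'S_n => f (perm_map g)).

Lemma endo_ker_nontriv : exists2 g, g \in endo_ker & g != 1.
Proof.
have /injectivePn[g [h gh E]] : ~~ injectiveb (fun g : 'S_n => f (perm_map g)).
  by apply/negP=> /injectiveP.
exists (g * h^-1); first by rewrite inE perm_mapM fM E -fM perm_mapV.
by rewrite -eq_mulgV1.
Qed.

(** The kernel meets the simple group Alt in a normal subgroup. It is
    nontrivial: a kernel element [g] moving [x] fails to commute with a
    transposition of [x] and some third point, and their commutator is an even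
    element of the kernel. *)
Lemma Alt_endo_ker : 'Alt_('I_n) \subset endo_ker.
Proof.
have [g gK g1] := endo_ker_nontriv.
have [x gx] : exists x, g x != x.
  apply/existsP; apply: contraNT g1 => /existsPn H; apply/eqP/permP=> x.
  by rewrite perm1; apply/eqP/negPn/H.
have [z []] : exists z, z != x /\ z != g x.
  have [z [w [zw zx zy]]] := two_others x (g x) (ltnW n5).
  have wz : w != z by rewrite eq_sym.
  by exists z; split; [move: zx|move: zy]; apply: contra_eq_neq => <-;
     rewrite tpermL.
move=> zx zgx; set k := [~ g, tperm x z].
have kK : k \in endo_ker by rewrite groupM ?groupV // endo_kerJ.
have kA : k \in 'Alt_('I_n).
  by rewrite Alt_even !odd_permM !odd_permV; case: odd_perm; case: odd_perm.
have k1 : k != 1.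
  apply/negP=> /commgP/(congr1 (fun p : 'S_n => p x)).
  rewrite !permM tpermL (tpermD _ zgx) 1?eq_sym // => /perm_inj xz.
  by rewrite xz eqxx in zx.
have /simpleP[_ Asimple] : simple 'Alt_('I_n) by rewrite simple_Alt5 // card_ord.
have KA : endo_ker_Group :&: 'Alt_('I_n) <| 'Alt_('I_n).
  apply/andP; split; first exact: subsetIr.
  apply/subsetP=> h hA; rewrite inE; apply/subsetP=> _ /imsetP[p /setIP[pK pA] ->].
  by rewrite inE endo_kerJ // groupJ.
have [K1|KE] := Asimple _ KA; last by rewrite -KE subsetIl.
have : k \in endo_ker_Group :&: 'Alt_('I_n) by rewrite inE kK.
by rewrite K1 => /set1gP/eqP; rewrite (negPf k1).
Qed.

Lemma endo_even g : ~~ odd_perm g -> f (perm_map g) = f 1.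
Proof.
by rewrite -Alt_even => /(subsetP Alt_endo_ker); rewrite inE => /eqP.
Qed.

Lemma endo_odd g h : odd_perm g -> odd_perm h -> f (perm_map g) = f (perm_map h).
Proof.
move=> go ho; rewrite -[g](mulgKV h) perm_mapM fM endo_even ?unit_mul //.
by rewrite odd_permM odd_permV go ho.
Qed.

(** All odd permutations have the same image, so the transposition of [x] and
    [y] can stand for [g]; it disappears in front of [collapse x y]. *)
Lemma endo_perm_collapse g x y : x != y ->
  f (perm_map g) * f (collapse x y) = f (collapse x y).
Proof.
move=> xy; have [go|ge] := boolP (odd_perm g); last by rewrite endo_even.
by rewrite (endo_odd (h := tperm x y)) ?odd_tperm // -fM tperm_collapse.
Qed.

(** Here the odd permutation is represented by a transposition disjoint from
    [x] and [y], which commutes with [collapse x y]. *)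
Lemma endo_collapse_perm g x y : x != y ->
  f (collapse x y) * f (perm_map g) = f (collapse x y).
Proof.
move=> xy; have [go|ge] := boolP (odd_perm g); last by rewrite endo_even.
have [z [w [zw zx zy]]] := two_others x y (ltnW n5).
rewrite (endo_odd (h := tperm z w)) ?odd_tperm //.
by rewrite -fM collapse_comm // fM endo_perm_collapse.
Qed.

Lemma endo_collapse x y x' y' : x != y -> x' != y' ->
  f (collapse x' y') = f (collapse x y).
Proof.
move=> xy xy'; have [g [<- <-]] := perm_2trans xy xy'.
by rewrite collapse_conj !fM endo_perm_collapse ?endo_collapse_perm.
Qed.

(** Induction on the corank, peeling off one rank n - 1 idempotent at a time. *)
Lemma endo_sing x y s : x != y -> s \notin symT n -> f s = f (collapse x y).
Proof.
move=> xy; have [k] := ubnP (n - #|codom s|); elim: k s => // k IHk s le_k sS.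
have [s' [z [v [zv sE lt_s]]]] := sing_factor sS.
rewrite sE fM (endo_collapse xy zv).
have [/symTP[g ->]|s'S] := boolP (s' \in symT n).
  exact: endo_perm_collapse.
rewrite (IHk s') // -?fM ?collapse_idem //.
rewrite ltnS in le_k; apply: leq_trans le_k; apply: ltn_sub2l => //.
by rewrite (leq_trans lt_s) // -[n in _ <= n]card_ord max_card.
Qed.

Lemma endo_ninj_phi : exists t e, f = phi t e.
Proof.
pose i0 : 'I_n := Ordinal (ltnW (ltnW (ltnW (ltnW n5)))).
have [x [y [xy _ _]]] := two_others i0 i0 (ltnW n5).
exists (f (perm_map (tperm x y))), (f (collapse x y)); apply/ffunP=> s.
case: s / (transP s) => [g go|g ge|s sS].
- by rewrite phi_odd // (endo_odd (h := tperm x y)) ?odd_tperm.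
- by rewrite phi_even // -fM -perm_mapM tperm2 perm_map1 endo_even.
- by rewrite phi_sing // (endo_sing xy).
Qed.

End EndoNonInj.

(** The theorem of Schein and Teclezghi. The two alternatives correspond to
    whether [f] is injective on the symmetric group. *)
Lemma endo_cases n (f : tmap (trans n)) : 4 < n -> f \in EndT n ->
  f \in AutT n \/ exists t e, f = phi t e.
Proof.
move=> n5 fE.
have [f_inj|f_ninj] := boolP (injectiveb (fun g : 'S_n => f (perm_map g))).
  by left; apply: (endo_inj_Aut _ fE (elimT (injectiveP _) f_inj));
     exact: leq_trans n5.
by right; apply: endo_ninj_phi => // H; case/injectiveP: f_ninj.
Qed.

(** * The monoid of endomorphisms and its principal right ideals *)

Lemma AutTP n (f : tmap (trans n)) :
  reflect (f \in EndT n /\ injective f) (f \in AutT n).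
Proof.
apply: (iffP setIdP) => [[fE /andP[/injectiveP finj _]]|[fE finj]] //.
split=> //; apply/andP; split; first exact/injectiveP.
by apply/forallP=> s; exact: injF_onto.
Qed.

Lemma AutT_End n (f : tmap (trans n)) : f \in AutT n -> f \in EndT n.
Proof. by case/AutTP. Qed.

Lemma EndT1 n : 1 \in EndT n.
Proof. by apply/EndTP=> s t; rewrite !tmap1. Qed.

Lemma EndTM n (a b : tmap (trans n)) :
  a \in EndT n -> b \in EndT n -> a * b \in EndT n.
Proof. by move=> /EndTP aM /EndTP bM; apply/EndTP=> s t; rewrite !tmapM aM bM. Qed.

Lemma AutT1 n : 1 \in AutT n.
Proof. by apply/AutTP; split=> [|s t]; rewrite ?EndT1 // !tmap1. Qed.

Lemma AutT_mul n (a b : tmap (trans n)) : a \in EndT n -> b \in EndT n ->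
  a * b \in AutT n -> a \in AutT n /\ b \in AutT n.
Proof.
move=> aE bE /AutTP[_ abinj].
have ainj : injective a by move=> s t E; apply: abinj; rewrite !tmapM E.
split; apply/AutTP; split=> // s t.
have [a' _ aK] := injF_bij ainj.
by rewrite -(aK s) -(aK t) -!tmapM => /abinj->.
Qed.

Lemma AutTV n (a : tmap (trans n)) : a \in AutT n ->
  exists b, [/\ b \in AutT n, a * b = 1 & b * a = 1].
Proof.
case/AutTP=> /EndTP aM ainj; have [a' a'K aK] := injF_bij ainj.
pose b : tmap (trans n) := [ffun s => a' s].
have bE s : b s = a' s by rewrite ffunE.
exists b; split; try by apply/ffunP=> s; rewrite tmapM tmap1 bE ?a'K ?aK.
apply/AutTP; split; last by move=> s t; rewrite !bE => /(can_inj aK).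
by apply/EndTP=> s t; apply: ainj; rewrite aM !bE !aK.
Qed.

Lemma mul_right_ideal n (a b : tmap (trans n)) :
  b \in EndT n -> a * b \in right_ideal a.
Proof. by move=> bE; apply/imsetP; exists b. Qed.

Lemma right_ideal_sub n (a b : tmap (trans n)) :
  b \in EndT n -> right_ideal (a * b) \subset right_ideal a.
Proof.
move=> bE; apply/subsetP=> _ /imsetP[c cE ->].
by rewrite -mulgA mul_right_ideal // EndTM.
Qed.

Lemma greenRP n (a b : tmap (trans n)) :
  reflect ((exists2 c, c \in EndT n & b = a * c) /\
           (exists2 d, d \in EndT n & a = b * d)) (greenR a b).
Proof.
apply: (iffP eqP) => [E|[[c cE bE] [d dE aE]]].
  have refl (c : tmap (trans n)) : c \in right_ideal c.
    by rewrite -{1}[c]mulg1 mul_right_ideal ?EndT1.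
  by split; apply/imsetP; [have := refl b; rewrite -E|have := refl a; rewrite E].
apply/eqP; rewrite eqEsubset.
by apply/andP; split; [rewrite {1}aE|rewrite {1}bE]; exact: right_ideal_sub.
Qed.

Lemma sym_idem n (s : trans n) : s \in symT n -> s * s = s -> s = 1.
Proof.
case/symTP=> g -> E; rewrite -[LHS]mulg1 -{1}(perm_mapV g) mulgA E.
exact: perm_mapV.
Qed.

(** * The endomorphisms phi t e *)

Lemma cst_sing n (i : 'I_n) : 1 < n -> cst i \notin symT n.
Proof.
move=> n1; rewrite symT_inj; apply/injectiveP=> H.
have : (Ordinal (ltnW n1)) = (Ordinal n1) by apply: H; rewrite !ffunE.
by case.
Qed.

Lemma phi_diag n (u s : trans n) : u * u = u -> phi u u s = u.
Proof.
move=> uu; case: s / (transP s) => [g go|g ge|s sS].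
- by rewrite phi_odd.
- by rewrite phi_even.
- by rewrite phi_sing.
Qed.

Lemma phi_mul n (t e : trans n) b : b \in EndT n ->
  phi t e * b = phi (b t) (b e).
Proof.
move/EndTP=> bM; apply/ffunP=> s; rewrite tmapM.
case: s / (transP s) => [g go|g ge|s sS].
- by rewrite !phi_odd.
- by rewrite !phi_even.
- by rewrite !phi_sing.
Qed.

Section Phi.
Variables (n : nat) (n1 : 1 < n).

Let x : 'I_n := Ordinal (ltnW n1).
Let y : 'I_n := Ordinal n1.
Let xy : x != y. Proof. by []. Qed.

Lemma phi_inj (t e t' e' : trans n) :
  phi t e = phi t' e' -> t = t' /\ e = e'.
Proof.
move/ffunP=> E; split.
  by have := E (perm_map (tperm x y)); rewrite !phi_odd ?odd_tperm.
by have := E (cst x); rewrite !phi_sing ?cst_sing.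
Qed.

Lemma phi_notAut (t e : trans n) : phi t e \notin AutT n.
Proof.
apply/AutTP=> -[_ inj]; have /ffunP/(_ x) : cst x = cst y.
  by apply: inj; rewrite !phi_sing ?cst_sing.
by rewrite !ffunE.
Qed.

Lemma phi_EndP (t e : trans n) :
  phi t e \in EndT n <-> [/\ t * t * t = t, t * e = e, e * t = e & e * e = e].
Proof.
split=> [/EndTP fM|[ttt te et ee]].
  pose g := tperm x y; have go : odd_perm g by rewrite odd_tperm.
  have cS := cst_sing x n1.
  have fg : phi t e (perm_map g) = t by rewrite phi_odd.
  have fc : phi t e (cst x) = e by rewrite phi_sing.
  split.
  - have := fM (perm_map g * perm_map g) (perm_map g).
    by rewrite (fM (perm_map g) (perm_map g)) -!perm_mapM tperm2 mul1g fg.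
  - by have := fM (perm_map g) (cst x); rewrite mul_cst fg fc.
  - by have := fM (cst x) (perm_map g); rewrite cst_mul fg fc phi_sing ?cst_sing.
  - by have := fM (cst x) (cst x); rewrite mul_cst fc.
apply/EndTP=> s s'.
case: s / (transP s) => [g go|g ge|s sS];
  case: s' / (transP s') => [h ho|h he|s' sS'].
- by rewrite -perm_mapM phi_even ?odd_permM ?go ?ho // !phi_odd.
- rewrite -perm_mapM phi_odd ?odd_permM ?go ?(negPf he) // phi_odd //.
  by rewrite phi_even // mulgA.
- by rewrite phi_odd // !phi_sing // (contra (@symT_mull _ _ _)).
- rewrite -perm_mapM phi_odd ?odd_permM ?ho ?(negPf ge) // phi_even //.
  by rewrite phi_odd // ttt.
- by rewrite -perm_mapM !phi_even ?odd_permM ?(negPf ge) // mulgA ttt.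
- by rewrite phi_even // !phi_sing -?mulgA ?te // (contra (@symT_mull _ _ _)).
- by rewrite phi_odd // !phi_sing // (contra (@symT_mulr _ _ _)).
- by rewrite phi_even // !phi_sing ?mulgA ?et // (contra (@symT_mulr _ _ _)).
- by rewrite !phi_sing // (contra (@symT_mull _ _ _)).
Qed.

Lemma phi_setE P (t e : trans n) :
  (phi t e \in phi_set P) = (phi t e \in EndT n) && P t e.
Proof.
rewrite 2!inE phi_notAut /=; congr andb.
apply/existsP/idP => [[t' /existsP[e' /andP[/eqP/phi_inj[<- <-]]]]|Pte] //.
by exists t; apply/existsP; exists e; rewrite eqxx.
Qed.

End Phi.

Lemma phi_setP n (P : trans n -> trans n -> bool) a : a \in phi_set P ->
  exists t e, [/\ a = phi t e, phi t e \in EndT n & P t e].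
Proof.
case/setIdP=> /setDP[aE _] /existsP[t /existsP[e /andP[/eqP E Pte]]].
by exists t, e; rewrite -E.
Qed.

Lemma phi_set_nonAut n (P : trans n -> trans n -> bool) a :
  a \in phi_set P -> a \in EndT n :\: AutT n.
Proof. by case/setIdP. Qed.

(** * Products of non-automorphisms and the right ideals *)

Section Ideals.
Variables (n : nat) (n5 : 4 < n).

Let n1 : 1 < n. Proof. exact: ltn_trans n5. Qed.

Local Notation idemPhi := (E2 n :|: clsC n :|: E1 n).
Local Notation nonAut := (EndT n :\: AutT n).

Lemma nonAutP a :
  reflect (exists t e, a = phi t e /\ phi t e \in EndT n) (a \in nonAut).
Proof.
apply: (iffP idP) => [|[t [e [-> aE]]]]; last by rewrite in_setD phi_notAut.
case/setDP=> aE aN; have [aA|[t [e E]]] := endo_cases n5 aE.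
  by rewrite aA in aN.
by exists t, e; rewrite -E.
Qed.

Lemma nonAut_mul a b : a \in EndT n -> b \in EndT n ->
  (a \in nonAut) || (b \in nonAut) -> a * b \in nonAut.
Proof.
move=> aE bE; rewrite !in_setD EndTM // aE bE !andbT -negb_and.
by apply: contra => /(AutT_mul aE bE)[-> ->].
Qed.

Lemma idem_ne1_sing (e : trans n) : e * e = e -> e != 1 -> e \notin symT n.
Proof. by move=> ee; apply: contra => /sym_idem/(_ ee)->. Qed.

(** The one case to be excluded is a singular [t] with [t * t = e], for which
    [t = t * t * t = e * t = e]. *)
Lemma endo_cover a : a \in EndT n ->
  a \in AutT n :|: E3 n :|: clsA n :|: E2 n :|: clsB n :|: clsC n :|: E1 n.
Proof.
move=> aE; rewrite !in_setU; have [//|aN] := boolP (a \in AutT n).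
have /nonAutP[t [e [-> tE]]] : a \in nonAut by rewrite in_setD aN.
have [ttt te et ee] := (phi_EndP n1 t e).1 tE.
rewrite /E3 /clsA /E2 /clsB /clsC /E1 !phi_setE // tE /=.
have [->|tne] := eqVneq t e; first by rewrite ?orbT.
have e1 : e != 1 by apply: contraNneq tne => e1; rewrite -te e1 mulg1.
rewrite e1 expg2 /=; case: t / (transP t) {tE te} ttt et tne
  => [g go|g ge|s sS] ttt et tne.
- by rewrite in_setD mem_symT mem_altT go.
- by rewrite mem_altT ge /=; case: eqP; rewrite ?orbT.
have [ss|ne] := eqVneq s (s * s); first by rewrite sS ?orbT.
suff -> : s * s != e by rewrite sS ?orbT.
by apply: contraNneq tne => sse; rewrite -ttt sse et.
Qed.

(** This description turns membership in the union of E2, C and E1 into an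
    equation, which every endomorphism preserves. *)
Lemma mem_idemPhi t e : phi t e \in EndT n -> (phi t e \in idemPhi) = (t * t == t).
Proof.
move=> tE; have [ttt te et ee] := (phi_EndP n1 t e).1 tE.
rewrite !in_setU /E2 /clsC /E1 !phi_setE // tE /= expg2.
apply/idP/eqP => [/orP[/orP[/andP[/eqP-> _]|]|/eqP->]|tt].
- by rewrite mul1g.
- by case/and4P=> _ /eqP<-.
- by [].
rewrite tt eqxx; have [->|tne] := eqVneq t e; first by rewrite ?orbT.
have e1 : e != 1 by apply: contraNneq tne => e1; rewrite -te e1 mulg1.
rewrite e1 orbF /=; have [//|t1] := eqVneq t 1.
by rewrite idem_ne1_sing.
Qed.

Lemma idemPhi_nonAut a : a \in idemPhi -> a \in nonAut.
Proof. by rewrite !in_setU => /orP[/orP[]|] /phi_set_nonAut. Qed.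

Lemma idemPhi_mul a b : a \in idemPhi -> b \in EndT n -> a * b \in idemPhi.
Proof.
move=> aD bE; have /nonAutP[t [e [E tE]]] := idemPhi_nonAut aD.
move: aD; rewrite E phi_mul // !mem_idemPhi //; last by rewrite -phi_mul // EndTM.
by move/eqP=> tt; rewrite -(EndTP _ bE) tt.
Qed.

Lemma E1_mul a b : a \in E1 n -> b \in EndT n -> a * b \in E1 n.
Proof.
case/phi_setP=> t [e [-> tE /eqP te]] bE.
by rewrite phi_mul // /E1 phi_setE // -phi_mul // EndTM // te eqxx.
Qed.

(** Elements of E1 are constant maps, that is, right zeros. *)
Lemma mul_E1 a b : b \in E1 n -> a * b = b.
Proof.
case/phi_setP=> t [e [-> tE /eqP te]]; subst e.
have [_ tt _ _] := (phi_EndP n1 t t).1 tE.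
by apply/ffunP=> s; rewrite tmapM !phi_diag.
Qed.

Lemma E3_mul a b : a \in E3 n -> b \in nonAut -> a * b = b.
Proof.
case/phi_setP=> t [e [-> tE /andP[to e1]]] /nonAutP[u [f [-> uE]]].
have [_ _ _ ee] := (phi_EndP n1 t e).1 tE.
rewrite phi_mul // (phi_sing _ _ (idem_ne1_sing ee e1)).
by rewrite ffunE to.
Qed.

(** If [a = phi t e], then [phi u f] sends the even [t] to [u * u] and the
    singular idempotent [e] to [f]. *)
Lemma AE2_mul a u f : a \in clsA n :|: E2 n -> phi u f \in EndT n ->
  a * phi u f = phi (u * u) f.
Proof.
move=> aAE uE.
have [t [e [-> tE tA e1]]] : exists t e,
    [/\ a = phi t e, phi t e \in EndT n, t \in altT n & e != 1].
  case/setUP: aAE => /phi_setP[t [e [-> tE H]]]; exists t, e; split=> //.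
  - by case/and3P: H.
  - by case/and3P: H.
  - by case/andP: H => /eqP-> _; rewrite -perm_map1 mem_altT odd_perm1.
  - by case/andP: H.
have [_ _ _ ee] := (phi_EndP n1 t e).1 tE.
rewrite phi_mul // (phi_sing _ _ (idem_ne1_sing ee e1)).
by case/imsetP: tA => g; rewrite Alt_even => ge ->; rewrite phi_even.
Qed.

Lemma AE2_mul_idemPhi a b :
  a \in clsA n :|: E2 n -> b \in nonAut -> a * b \in idemPhi.
Proof.
move=> aAE /nonAutP[u [f [-> uE]]].
have aE : a \in EndT n by case/setUP: aAE => /phi_set_nonAut/setDP[].
have := EndTM aE uE; rewrite AE2_mul // => uuE; rewrite mem_idemPhi //.
by have [uuu _ _ _] := (phi_EndP n1 u f).1 uE; rewrite mulgA uuu.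
Qed.

Lemma AE2_mul_id a b : a \in clsA n :|: E2 n -> b \in idemPhi -> a * b = b.
Proof.
move=> aAE bD; have /nonAutP[u [f [E uE]]] := idemPhi_nonAut bD.
by move: bD; rewrite E mem_idemPhi // AE2_mul // => /eqP->.
Qed.

Lemma BC_mul a b : a \in clsB n :|: clsC n -> b \in nonAut -> a * b \in E1 n.
Proof.
move=> aBC /nonAutP[u [f [-> uE]]].
have aE : a \in EndT n by case/setUP: aBC => /phi_set_nonAut/setDP[].
have abE := EndTM aE uE; move: abE.
have [t [e [-> tE tS e1]]] : exists t e,
    [/\ a = phi t e, phi t e \in EndT n, t \notin symT n & e != 1].
  case/setUP: aBC => /phi_setP[t [e [-> tE /and4P[]]]]; by exists t, e.
have [_ _ _ ee] := (phi_EndP n1 t e).1 tE.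
rewrite phi_mul // !phi_sing ?(idem_ne1_sing ee e1) // => ffE.
by rewrite /E1 phi_setE // ffE eqxx.
Qed.

Lemma right_ideal_Aut a : a \in AutT n -> right_ideal a = EndT n.
Proof.
move=> aA; have [b [bA ab _]] := AutTV aA.
apply/eqP; rewrite eqEsubset; apply/andP; split; apply/subsetP.
  by move=> _ /imsetP[c cE ->]; rewrite EndTM // AutT_End.
by move=> c cE; rewrite -[c]mul1g -ab -mulgA mul_right_ideal // EndTM // AutT_End.
Qed.

(** Right multiplication by an automorphism stays in the orbit, and any other
    multiplier lands in [X]; conversely [a] fixes [X] pointwise, so [X] lies in
    its right ideal. *)
Lemma right_ideal_orbit a (X : {set tmap (trans n)}) :
  {in nonAut, forall b, a * b \in X} -> {in X, forall b, a * b = b} ->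
  X \subset nonAut -> right_ideal a = Aut_orbit a :|: X.
Proof.
move=> aN aX XN; apply/eqP; rewrite eqEsubset; apply/andP; split; apply/subsetP.
  move=> _ /imsetP[b bE ->]; rewrite in_setU.
  have [bA|bA] := boolP (b \in AutT n); first by rewrite imset_f.
  by rewrite aN ?orbT // in_setD bA.
move=> b /setUP[/imsetP[c cA ->]|bX]; first by rewrite mul_right_ideal // AutT_End.
by rewrite -(aX b bX) mul_right_ideal //; have /setDP[] := subsetP XN b bX.
Qed.

Lemma orbit_sub a (X : {set tmap (trans n)}) :
  {in X & EndT n, forall b c, b * c \in X} -> a \in X -> Aut_orbit a :|: X = X.
Proof.
move=> XM aX; apply/setUidPr/subsetP=> _ /imsetP[b bA ->].
by rewrite XM // AutT_End.
Qed.

Lemma idemPhi_sub : idemPhi \subset nonAut.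
Proof. by apply/subsetP; exact: idemPhi_nonAut. Qed.

Lemma E1_sub : E1 n \subset nonAut.
Proof. by apply/subsetP=> a /phi_set_nonAut. Qed.

Lemma nonAut_mulr : {in nonAut & EndT n, forall b c, b * c \in nonAut}.
Proof. by move=> b c bN cE; rewrite nonAut_mul ?bN //; case/setDP: bN. Qed.

Lemma right_ideal_E3 a : a \in E3 n -> right_ideal a = nonAut.
Proof.
move=> aE3; have aN := phi_set_nonAut aE3; have /setDP[aE _] := aN.
rewrite (right_ideal_orbit (X := nonAut)) //.
- by rewrite (orbit_sub nonAut_mulr).
- by move=> b bN; rewrite nonAut_mulr //; case/setDP: bN.
- by move=> b; exact: E3_mul.
Qed.

Lemma right_ideal_AE2 a : a \in clsA n :|: E2 n ->
  right_ideal a = Aut_orbit a :|: idemPhi.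
Proof.
by move=> aAE; apply: right_ideal_orbit idemPhi_sub => b;
   [exact: AE2_mul_idemPhi|exact: AE2_mul_id].
Qed.

Lemma right_ideal_E2 a : a \in E2 n -> right_ideal a = idemPhi.
Proof.
move=> aE2; rewrite right_ideal_AE2; last by rewrite in_setU aE2 orbT.
by rewrite orbit_sub ?in_setU ?aE2 //; exact: idemPhi_mul.
Qed.

Lemma right_ideal_BC a : a \in clsB n :|: clsC n ->
  right_ideal a = Aut_orbit a :|: E1 n.
Proof.
by move=> aBC; apply: right_ideal_orbit E1_sub => b; [exact: BC_mul|exact: mul_E1].
Qed.

Lemma right_ideal_E1 a : a \in E1 n -> right_ideal a = E1 n.
Proof.
move=> aE1; rewrite (right_ideal_orbit (X := E1 n)) ?E1_sub //.
- by rewrite (orbit_sub E1_mul).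
- by move=> b /setDP[bE _]; exact: E1_mul.
- by move=> b; exact: mul_E1.
Qed.

(** * Green's R-classes *)

Lemma E3_not_idemPhi a : a \in E3 n -> a \notin idemPhi.
Proof.
case/phi_setP=> t [e [-> tE /andP[/setDP[tS tA] _]]]; rewrite mem_idemPhi //.
apply: contra tA => /eqP/(sym_idem tS)->.
by rewrite -perm_map1 mem_altT odd_perm1.
Qed.

Lemma A_not_idemPhi a : a \in clsA n -> a \notin idemPhi.
Proof.
case/phi_setP=> t [e [-> tE /and3P[/altT_sub tS t1 _]]]; rewrite mem_idemPhi //.
by apply: contra t1 => /eqP/(sym_idem tS)->.
Qed.

Lemma E2BC_notE1 a : a \in E2 n :|: clsB n :|: clsC n -> a \notin E1 n.
Proof.
move=> aE; apply/negP=> /phi_setP[t [e [E tE /eqP te]]]; subst e.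
have [_ tt _ _] := (phi_EndP n1 t t).1 tE.
move: aE; rewrite E !in_setU /E2 /clsB /clsC !phi_setE // tE expg2 tt !eqxx /=.
by rewrite !andbF; case: eqP.
Qed.

Local Notation Rclass a := [set b in EndT n | greenR a b].

Lemma Rclass_Aut a : a \in AutT n -> Rclass a = AutT n.
Proof.
move=> aA; have aE := AutT_End aA; apply/setP=> b; rewrite in_set.
apply/andP/idP => [[bE /greenRP[_ [d dE ad]]]|bA].
  by rewrite ad in aA; have [] := AutT_mul bE dE aA.
by rewrite AutT_End // /greenR !right_ideal_Aut.
Qed.

(** As [a] is a left identity on non-automorphisms, [a = b * d] gives
    [a = b * (d * a)]; for [b] of any type but E3 such a product lies in the
    union of E2, C and E1, which [a] avoids. *)
Lemma Rclass_E3 a : a \in E3 n -> Rclass a = E3 n.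
Proof.
move=> aE3; have aN := phi_set_nonAut aE3; have /setDP[aE _] := aN.
apply/setP=> b; rewrite in_set; apply/andP/idP => [[bE ]|bE3]; last first.
  by rewrite /greenR !right_ideal_E3 //; have /setDP[-> _] := phi_set_nonAut bE3.
case/greenRP=> [[c cE bac] [d dE abd]].
have abN : a = b * (d * a) by rewrite mulgA -abd E3_mul.
have daN : d * a \in nonAut by rewrite nonAut_mul ?aN ?orbT.
have bN : b \in nonAut by rewrite bac nonAut_mulr.
have aD := E3_not_idemPhi aE3.
move: (endo_cover bE); rewrite !in_setU; have /setDP[_ /negPf->] := bN.
have [//|_ /=] := boolP (b \in E3 n).
have [bA|_] := boolP (b \in clsA n).
  by case/negP: aD; rewrite abN AE2_mul_idemPhi // in_setU bA.
have [bA|_] := boolP (b \in E2 n).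
  by case/negP: aD; rewrite abN AE2_mul_idemPhi // in_setU bA orbT.
rewrite /=; case/orP=> [bBC|bE1]; case/negP: aD; rewrite in_setU; apply/orP; right.
  by rewrite abN BC_mul // in_setU.
by rewrite abd E1_mul.
Qed.

(** As [a] is idempotent, [a = b * d] gives [a = b * (d * a)], which lies in E1
    when [b] is in C. *)
Lemma Rclass_E2 a : a \in E2 n -> Rclass a = E2 n.
Proof.
move=> aE2; have aN := phi_set_nonAut aE2; have /setDP[aE _] := aN.
have aD : a \in idemPhi by rewrite !in_setU aE2.
apply/setP=> b; rewrite in_set; apply/andP/idP => [[bE ]|bE2]; last first.
  by rewrite /greenR !right_ideal_E2 //; have /setDP[-> _] := phi_set_nonAut bE2.
case/greenRP=> [[c cE bac] [d dE abd]].
have abN : a = b * (d * a).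
  by rewrite mulgA -abd AE2_mul_id // in_setU aE2 orbT.
have daN : d * a \in nonAut by rewrite nonAut_mul ?aN ?orbT.
have aE1 : a \notin E1 n by rewrite E2BC_notE1 // !in_setU aE2.
have : b \in idemPhi by rewrite bac idemPhi_mul.
case/setUP=> [/setUP[//|bC]|bE1]; case/negP: aE1; last by rewrite abd E1_mul.
by rewrite abN BC_mul // in_setU bC orbT.
Qed.

Lemma Rclass_E1 a : a \in E1 n -> Rclass a = E1 n.
Proof.
move=> aE1; apply/setP=> b; rewrite in_set; apply/andP/idP => [[bE ]|bE1].
  by case/greenRP=> [[c cE ->] _]; exact: E1_mul.
by rewrite /greenR !right_ideal_E1 //; have /setDP[-> _] := phi_set_nonAut bE1.
Qed.

(** If [b = a * c] with [c] not an automorphism, then [b] lies in a right ideal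
    avoiding [a]: the union of E2, C and E1 when [a] is in A, and E1 when [a] is
    in B or C. *)
Lemma Rclass_ABC a : a \in clsA n :|: clsB n :|: clsC n ->
  Rclass a = Aut_orbit a.
Proof.
move=> aABC.
have aE : a \in EndT n.
  by case/setUP: aABC => [/setUP[]|] /phi_set_nonAut/setDP[].
apply/setP=> b; rewrite in_set; apply/andP/imsetP => [[bE ]|[c cA ->]]; last first.
  have [d [dA cd _]] := AutTV cA; split; first by rewrite EndTM // AutT_End.
  apply/greenRP; split; [exists c|exists d]; rewrite ?AutT_End //.
  by rewrite -mulgA cd mulg1.
case/greenRP=> [[c cE bac] [d dE abd]]; exists c => //.
apply: contraT => cA; have cN : c \in nonAut by rewrite in_setD cA.
move: aABC; rewrite -setUA => /setUP[aA|aBC].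
  have bD : b \in idemPhi by rewrite bac AE2_mul_idemPhi // in_setU aA.
  by case/negP: (A_not_idemPhi aA); rewrite abd idemPhi_mul.
have bE1 : b \in E1 n by rewrite bac BC_mul.
suff /negP[] : a \notin E1 n by rewrite abd E1_mul.
by apply: E2BC_notE1; rewrite -setUA in_setU aBC orbT.
Qed.

(** A transposition paired with the constant at a point that it fixes. *)
Lemma E3_nonempty : exists a, a \in E3 n.
Proof.
pose x := Ordinal (ltnW n1); pose y := Ordinal n1.
have [z [w [zw zx zy]]] := two_others x y (ltnW n5).
exists (phi (perm_map (tperm z w)) (cst x)).
rewrite /E3 phi_setE // in_setD mem_symT mem_altT odd_tperm zw /=.
apply/andP; split; last first.
  by apply: contraNneq (cst_sing x n1) => ->; rewrite -perm_map1 mem_symT.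
apply/(phi_EndP n1); split; rewrite ?mul_cst //.
  by rewrite -!perm_mapM tperm2 mul1g.
by rewrite cst_mul ffunE zx.
Qed.

Lemma E2_nonempty : exists a, a \in E2 n.
Proof.
pose x := Ordinal (ltnW n1); exists (phi 1 (cst x)).
rewrite /E2 phi_setE // eqxx /=; apply/andP; split; last first.
  by apply: contraNneq (cst_sing x n1) => ->; rewrite -perm_map1 mem_symT.
by apply/(phi_EndP n1); split; rewrite ?mul_cst ?mul1g ?mulg1.
Qed.

Lemma E1_nonempty : exists a, a \in E1 n.
Proof.
exists (phi 1 1); rewrite /E1 phi_setE // eqxx andbT.
by apply/(phi_EndP n1); rewrite !mul1g.
Qed.

End Ideals.

Theorem proposition5p3 (n : nat) (hn : 5 <= n) :
  (forall a : tmap (trans n), a \in EndT n ->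
     a \in AutT n :|: E3 n :|: clsA n :|: E2 n :|: clsB n :|: clsC n :|: E1 n
     /\ (a \in AutT n -> right_ideal a = EndT n)
     /\ (a \in E3 n -> right_ideal a = EndT n :\: AutT n)
     /\ (forall t e : trans n, a = phi t e -> a \in clsA n ->
           right_ideal a = Aut_orbit (phi t e) :|: E2 n :|: clsC n :|: E1 n)
     /\ (a \in E2 n -> right_ideal a = E2 n :|: clsC n :|: E1 n)
     /\ (forall t e : trans n, a = phi t e -> a \in clsB n ->
           right_ideal a = Aut_orbit (phi t e) :|: E1 n)
     /\ (forall t e : trans n, a = phi t e -> a \in clsC n ->
           right_ideal a = Aut_orbit (phi t e) :|: E1 n)
     /\ (a \in E1 n -> right_ideal a = E1 n))
  /\ [/\ AutT n \in R_classes n, E3 n \in R_classes n,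
         E2 n \in R_classes n & E1 n \in R_classes n]
  /\ (forall K : {set tmap (trans n)}, K \in R_classes n ->
        K \notin [:: AutT n; E3 n; E2 n; E1 n] ->
        exists2 a, a \in clsA n :|: clsB n :|: clsC n & K = Aut_orbit a).
Proof.
have [a3 a3E] := E3_nonempty hn; have [a2 a2E] := E2_nonempty hn.
have [a1 a1E] := E1_nonempty hn.
split; last split.
- move=> a aE; split; first exact: endo_cover.
  split; first exact: right_ideal_Aut.
  split; first exact: right_ideal_E3.
  split; first by move=> t e <- aA; rewrite right_ideal_AE2 ?setUA // in_setU aA.
  split; first exact: right_ideal_E2.
  split; first by move=> t e <- aB; rewrite right_ideal_BC // in_setU aB.
  split; last exact: right_ideal_E1.
  by move=> t e <- aC; rewrite right_ideal_BC // in_setU aC orbT.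
- split; apply/imsetP.
  + by exists 1; rewrite ?EndT1 // Rclass_Aut // AutT1.
  + by exists a3; [have /setDP[] := phi_set_nonAut a3E|rewrite Rclass_E3].
  + by exists a2; [have /setDP[] := phi_set_nonAut a2E|rewrite Rclass_E2].
  + by exists a1; [have /setDP[] := phi_set_nonAut a1E|rewrite Rclass_E1].
move=> _ /imsetP[a aE ->]; rewrite !in_cons in_nil !negb_or => /and5P[KA K3 K2 K1 _].
have aABC : a \in clsA n :|: clsB n :|: clsC n.
  move: (endo_cover hn aE); rewrite !in_setU.
  have [aA|_] := boolP (a \in AutT n); first by rewrite Rclass_Aut ?eqxx in KA.
  have [a3'|_] := boolP (a \in E3 n); first by rewrite Rclass_E3 ?eqxx in K3.
  have [a2'|_] := boolP (a \in E2 n); first by rewrite Rclass_E2 ?eqxx in K2.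
  have [a1'|_] := boolP (a \in E1 n); first by rewrite Rclass_E1 ?eqxx in K1.
  by rewrite !orbF.
by exists a => //; exact: Rclass_ABC.
Qed.
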